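(* Let $\mathbb{O}$ denote the real octonions and let $$\mathcal{A}=\begin{pmatrix} d & a & \overline{b}\\ \overline{a} & e & c\\ b & \overline{c} & f\end{pmatrix},\qquad d,e,f\in\mathbb{R},\quad a,b,c\in\mathbb{O},$$ be a $3\times 3$ octonionic Hermitian matrix such that $\alpha:=(ab)c-a(bc)\neq 0$. Let $\Phi=\tfrac12\operatorname{Re}\big(a(\overline{b}c)-c(\overline{b}a)\big)$, let $r_1\ne r_2$ be the two real roots of $r^2+4\Phi r-|\alpha|^2=0$, let $K:\mathbb{O}^3\to\mathbb{O}^3$ be the characteristic operator $$K[x]=\mathcal{A}\big(\mathcal{A}(\mathcal{A}x)\big)-(\operatorname{tr}\mathcal{A})\,\mathcal{A}(\mathcal{A}x)+\sigma(\mathcal{A})\,\mathcal{A}x-(\det\mathcal{A})\,x ,$$ and for $m=1,2$ let $$K_m=\frac{K+r_m+4\Phi}{2(r_m+2\Phi)} .$$ For each $m\in\{1,2\}$ let $v_{m,1},v_{m,2},v_{m,3}\in\mathbb{O}^3$ be an orthonormal family of eigenvectors of $\mathcal{A}$ belonging to $r_m$, with $\mathcal{A}v_{m,j}=\lambda_{m,j}v_{m,j}$, $\lambda_{m,j}\in\mathbb{R}$, and $K[v_{m,j}]=r_m v_{m,j}$ for $j=1,2,3$. Then every $x\in\mathbb{O}^3$ is the sum of six terms $$x=\sum_{m=1}^{2}\sum_{j=1}^{3}\big(v_{m,j}v_{m,j}^\dagger\big)K_m[x],$$ and each term lies in the corresponding eigenspace of $\mathcal{A}$: $$\mathcal{A}\Big(\big(v_{m,j}v_{m,j}^\dagger\big)K_m[x]\Big)=\lambda_{m,j}\,\big(v_{m,j}v_{m,j}^\dagger\big)K_m[x]\qquad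 (m=1,2;\ j=1,2,3).$$
   Context: $\mathbb{O}$ is the 8-dimensional real division algebra of octonions (nonassociative, alternative), with conjugation $p\mapsto\overline{p}$, real part $\operatorname{Re}(p)=\tfrac12(p+\overline p)$ and norm $|p|^2=p\overline p$. Vectors in $\mathbb{O}^3$ are column vectors; $v^\dagger$ is the conjugate transpose (a row vector); matrix products and matrix-vector products are computed by the usual row-by-column rule, with the parentheses as written. Thus $vv^\dagger$ is the $3\times3$ Hermitian matrix with entries $v_i\overline{v_j}$, and $v^\dagger v=\sum_i|v_i|^2\in\mathbb{R}$. For the matrix $\mathcal{A}$ displayed in the claim, $\operatorname{tr}\mathcal{A}=d+e+f$, $\sigma(\mathcal{A})=\tfrac12\big((\operatorname{tr}\mathcal{A})^2-\operatorname{tr}(\mathcal{A}^2)\big)$, and $\det\mathcal{A}$ is the Freudenthal determinant $$\det\mathcal{A}=def+2\operatorname{Re}\big(b(ac)\big)-d|c|^2-e|b|^2-f|a|^2 .$$ Two vectors $u,v\in\mathbb{O}^3$ are called orthogonal if $(uu^\dagger)v=0=(vv^\dagger)u$. A family of three eigenvectors $v_1,v_2,v_3$ of $\mathcal{A}$ with the same $K$-eigenvalue is called orthonormal if $v_j^\dagger v_j=1$ for all $j$ and the $v_j$ are pairwise orthogonal; this is also expressed as $\mathcal{I}=\sum_{j=1}^3 v_jv_j^\dagger$, where $\mathcal{I}$ is the $3\times 3$ identity matrix, and for such a family with eigenvalues $\lambda_j$ one has $\mathcal{A}=\sum_{j=1}^3\lambda_j v_jv_j^\dagger$ (known from earlier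 work, as is the existence of such a family for each of $r_1,r_2$). *)

(* Defs.v *)
From HB Require Import structures.
From mathcomp Require Import all_boot all_order all_algebra.
From mathcomp Require Import reals.
From mathcomp Require Import ring.

Set Implicit Arguments.
Unset Strict Implicit.
Unset Printing Implicit Defensive.

Import Order.TTheory GRing.Theory Num.Theory.
Local Open Scope ring_scope.

(* The octonions are obtained from the reals by three Cayley-Dickson          *)
(* doublings.  A record rather than V * V, which would bring in the           *)
(* componentwise ring structure of pairs.                                     *)
Record cd (V : Type) : Type := CD { cdl : V; cdr : V }.

Section CayleyDicksonZmodule.
Variable V : zmodType.

Definition cd_pair (p : cd V) : V * V := (cdl p, cdr p).
Definition pair_cd (p : V * V) : cd V := CD p.1 p.2.

Lemma cd_pairK : cancel cd_pair pair_cd. Proof. by case. Qed.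

HB.instance Definition _ := Choice.copy (cd V) (can_type cd_pairK).

Definition cd_zero : cd V := CD 0 0.
Definition cd_opp (p : cd V) : cd V := CD (- cdl p) (- cdr p).
Definition cd_add (p q : cd V) : cd V := CD (cdl p + cdl q) (cdr p + cdr q).

Lemma cd_addA : associative cd_add.
Proof. by move=> p q r; congr CD; apply: addrA. Qed.

Lemma cd_addC : commutative cd_add.
Proof. by move=> p q; congr CD; apply: addrC. Qed.

Lemma cd_add0 : left_id cd_zero cd_add.
Proof. by case=> p q; congr CD; apply: add0r. Qed.

Lemma cd_addN : left_inverse cd_zero cd_opp cd_add.
Proof. by move=> p; congr CD; apply: addNr. Qed.

HB.instance Definition _ :=
  GRing.isZmodule.Build (cd V) cd_addA cd_addC cd_add0 cd_addN.

End CayleyDicksonZmodule.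

Section CayleyDicksonLmodule.
Variables (R : pzRingType) (V : lmodType R).

Definition cd_scale (r : R) (p : cd V) : cd V := CD (r *: cdl p) (r *: cdr p).

Lemma cd_scaleA r s p : cd_scale r (cd_scale s p) = cd_scale (r * s) p.
Proof. by congr CD; apply: scalerA. Qed.

Lemma cd_scale1 : left_id 1 cd_scale.
Proof. by case=> p q; congr CD; apply: scale1r. Qed.

Lemma cd_scaleDr : right_distributive cd_scale +%R.
Proof. by move=> r p q; congr CD; apply: scalerDr. Qed.

Lemma cd_scaleDl p : {morph cd_scale^~ p : r s / r + s}.
Proof. by move=> r s; congr CD; apply: scalerDl. Qed.

HB.instance Definition _ :=
  GRing.Zmodule_isLmodule.Build R (cd V)
    cd_scaleA cd_scale1 cd_scaleDr cd_scaleDl.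

End CayleyDicksonLmodule.

Section CayleyDicksonProduct.
Variables (V : zmodType) (mul : V -> V -> V) (conj : V -> V).

Definition cd_conj (p : cd V) : cd V := CD (conj (cdl p)) (- cdr p).

Definition cd_mul (p q : cd V) : cd V :=
  CD (mul (cdl p) (cdl q) - mul (conj (cdr q)) (cdr p))
     (mul (cdr q) (cdl p) + mul (cdr p) (conj (cdl q))).

End CayleyDicksonProduct.

Section Octonions.
Variable R : realType.

Definition oct := cd (cd (cd R^o)).

Definition oconj : oct -> oct := cd_conj (cd_conj (cd_conj (@id R^o))).

Definition omul : oct -> oct -> oct :=
  cd_mul (cd_mul (cd_mul (fun x y : R^o => x * y : R^o) (@id R^o))
                 (cd_conj (@id R^o)))
         (cd_conj (cd_conj (@id R^o))).

(* r * 1 in the octonions *)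
Definition oreal (r : R) : oct := CD (CD (CD r 0) 0) 0.

Definition ore (p : oct) : R := cdl (cdl (cdl p)).

Definition onormsq (p : oct) : R := ore (omul p (oconj p)).

End Octonions.

Arguments oconj {R} p.
Arguments omul {R} p q.
Arguments oreal {R} r.
Arguments ore {R} p.
Arguments onormsq {R} p.

Declare Scope oct_scope.
Delimit Scope oct_scope with O.
Notation "p *o q" := (omul p q)
  (at level 40, left associativity) : oct_scope.
Local Open Scope oct_scope.

Section OctonionFacts.
Variable R : realType.
Implicit Types (p q : oct R) (r : R).

Lemma oreE p : oreal (ore p) = 2^-1 *: (p + oconj p).
Proof.
case: p => [[[p0 p1] [p2 p3]] [[p4 p5] [p6 p7]]].
have half (x : R) : 2^-1 * (x + x) = x by field.
by do 3!congr CD; rewrite /GRing.scale /= ?subrr ?mulr0 ?half.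
Qed.

Lemma onormsqE p : oreal (onormsq p) = p *o oconj p.
Proof.
case: p => [[[p0 p1] [p2 p3]] [[p4 p5] [p6 p7]]].
by do 3!congr CD; rewrite /onormsq /ore /=; ring.
Qed.

Lemma onormsq_coord p :
  onormsq p =
    (cdl (cdl (cdl p))) ^+ 2 + (cdr (cdl (cdl p))) ^+ 2
    + (cdl (cdr (cdl p))) ^+ 2 + (cdr (cdr (cdl p))) ^+ 2
    + (cdl (cdl (cdr p))) ^+ 2 + (cdr (cdl (cdr p))) ^+ 2
    + (cdl (cdr (cdr p))) ^+ 2 + (cdr (cdr (cdr p))) ^+ 2.
Proof.
case: p => [[[p0 p1] [p2 p3]] [[p4 p5] [p6 p7]]].
by rewrite /onormsq /ore /=; ring.
Qed.

Lemma onormsqM p q : onormsq (p *o q) = onormsq p * onormsq q.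
Proof.
case: p => [[[p0 p1] [p2 p3]] [[p4 p5] [p6 p7]]].
case: q => [[[q0 q1] [q2 q3]] [[q4 q5] [q6 q7]]].
by rewrite !onormsq_coord /=; ring.
Qed.

Lemma oscaleE r p : r *: p = oreal r *o p.
Proof.
case: p => [[[p0 p1] [p2 p3]] [[p4 p5] [p6 p7]]].
by do 3!congr CD; rewrite /GRing.scale /=; ring.
Qed.

End OctonionFacts.

Section Matrices.
Variable R : realType.

(* *m needs an associative coefficient ring *)
Definition omulmx m n k (M : 'M[oct R]_(m, n)) (N : 'M[oct R]_(n, k)) :
    'M[oct R]_(m, k) :=
  \matrix_(i, j) \sum_l (M i l *o N l j).

Definition dagger m n (M : 'M[oct R]_(m, n)) : 'M[oct R]_(n, m) :=
  map_mx oconj M^T.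

(* matrices over oct R are not an lmodType over R *)
Definition oscale m n (r : R) (M : 'M[oct R]_(m, n)) : 'M[oct R]_(m, n) :=
  map_mx (fun z => r *: z) M.

End Matrices.

Notation "M *om N" := (omulmx M N)
  (at level 40, left associativity) : oct_scope.
Notation "M ^†" := (dagger M) (at level 2, format "M ^†") : oct_scope.
Notation "r *v M" := (oscale r M)
  (at level 40, left associativity) : oct_scope.

Section Eigenvalues.
Variable R : realType.
Implicit Types (x u v : 'cV[oct R]_3).

Definition orthogonal_vec u v : Prop :=
  (u *om u^†) *om v = 0 /\ (v *om v^†) *om u = 0.

Definition orthonormal_family (v : 'I_3 -> 'cV[oct R]_3) : Prop :=
  (forall j, ((v j)^† *om v j) 0 0 = oreal 1) /\
  (forall i j, i != j -> orthogonal_vec (v i) (v j)).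

Variables (d e f : R) (a b c : oct R).

Definition herm : 'M[oct R]_3 :=
  \matrix_(i, j)
    nth 0 (nth [::] [:: [:: oreal d;  a;        oconj b];
                        [:: oconj a;  oreal e;  c      ];
                        [:: b;        oconj c;  oreal f]] i) j.

Definition herm_tr : R := d + e + f.

(* the trace of the square is real: tr_herm_sq *)
Definition herm_sigma : R :=
  2^-1 * (herm_tr ^+ 2 - ore (\tr (herm *om herm))).

Definition herm_det : R :=
  d * e * f + 2 * ore (b *o (a *o c))
  - d * onormsq c - e * onormsq b - f * onormsq a.

Definition alpha : oct R := (a *o b) *o c - a *o (b *o c).

Definition Phi : R :=
  2^-1 * ore (a *o (oconj b *o c) - c *o (oconj b *o a)).

Definition charK x : 'cV[oct R]_3 :=
  herm *om (herm *om (herm *om x)) - herm_tr *v (herm *om (herm *om x))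
  + herm_sigma *v (herm *om x) - herm_det *v x.

(* the operator K_m is projK r_m *)
Definition projK (r : R) x : 'cV[oct R]_3 :=
  (2 * (r + 2 * Phi))^-1 *v (charK x + (r + 4 * Phi) *v x).

Lemma tr_herm : \tr herm = oreal herm_tr.
Proof.
rewrite /mxtrace !big_ord_recl big_ord0 !mxE /=.
by do 3!congr CD; rewrite /herm_tr /=; ring.
Qed.

Lemma herm_dagger : herm^† = herm.
Proof.
have oconjK : involutive (@oconj R).
  by move=> [[[p0 p1] [p2 p3]] [[p4 p5] [p6 p7]]]; rewrite /oconj /cd_conj /= !opprK.
have oconjr r : oconj (oreal r) = oreal r.
  by rewrite /oconj /cd_conj /= !oppr0.
apply/matrixP => i j; rewrite !mxE.
by case: i => [[|[|[|//]]]] ?; case: j => [[|[|[|//]]]] ? /=; rewrite ?oconjK.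
Qed.

Lemma tr_herm_sq : \tr (herm *om herm) =
  oreal (d ^+ 2 + e ^+ 2 + f ^+ 2
         + 2 * (onormsq a + onormsq b + onormsq c)).
Proof.
rewrite /mxtrace !big_ord_recl big_ord0 !mxE !big_ord_recl !big_ord0 !mxE /=.
rewrite !onormsq_coord.
case: a => [[[a0 a1] [a2 a3]] [[a4 a5] [a6 a7]]].
case: b => [[[b0 b1] [b2 b3]] [[b4 b5] [b6 b7]]].
case: c => [[[c0 c1] [c2 c3]] [[c4 c5] [c6 c7]]].
by do 3!congr CD; rewrite /=; ring.
Qed.

End Eigenvalues.

(* Main.v *)
(* The characteristic operator K acts on the three coordinates of a vector by one and
   the same map k of the octonions, independent of d, e, f:
     k x = im a (im c (im b x)) - im b (im c (im a x)) - 2 Phi x.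
   Replacing im a, im c, im b by orthogonal imaginary i, j, k (Gram-Schmidt), the
   first two terms become T = 2 i(j(k .)), whose square is a scalar. On an eigenspace
   E of T with nonzero eigenvalue, left multiplications by M = span(1, i, j, k) form a
   quaternion algebra, and u w^- lies in M for all u, w in E. As an element of M is
   determined by its value at w, this gives p((u w^-) y) = ((p u) w^-) y for p in M and
   u, w, y in E. All entries of A lie in M, hence A((v v^+) y) = ((A v) v^+) y when all
   coordinates of v and y lie in E, as is the case for v_{m,j} and K_m[x].
   The decomposition of x follows from K_1 + K_2 = 1 and sum_j v_{m,j} v_{m,j}^+ = 1. *)
Require Import Defs.
From mathcomp Require Import all_boot all_order all_algebra.
From mathcomp Require Import reals.
From mathcomp Require Import ring.

Import GRing.Theory Num.Theory.
Local Open Scope ring_scope.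
Local Open Scope oct_scope.

(** * Real coordinates of the octonions and the identities of a composition algebra *)

Section OctonionAlgebra.
Context {R : realType}.
Implicit Types (p q u w x y : oct R) (s t : R).

(** Indices from 8 on give 0, so linearity and extensionality need no range condition. *)
Definition ocoord (i : nat) p : R :=
  nth 0 [:: cdl (cdl (cdl p)); cdr (cdl (cdl p));
            cdl (cdr (cdl p)); cdr (cdr (cdl p));
            cdl (cdl (cdr p)); cdr (cdl (cdr p));
            cdl (cdr (cdr p)); cdr (cdr (cdr p))] i.

Lemma oct_ext p q : (forall i, ocoord i p = ocoord i q) -> p = q.
Proof.
case: p => [[[p0 p1] [p2 p3]] [[p4 p5] [p6 p7]]].
case: q => [[[q0 q1] [q2 q3]] [[q4 q5] [q6 q7]]] h.
move: (h 0%N) (h 1%N) (h 2%N) (h 3%N) (h 4%N) (h 5%N) (h 6%N) (h 7%N).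
by rewrite /ocoord /= => -> -> -> -> -> -> -> ->.
Qed.

Lemma ocoordD i p q : ocoord i (p + q) = ocoord i p + ocoord i q.
Proof. by do 8?[case: i => [//|i]]; rewrite /ocoord /= !nth_nil addr0. Qed.

Lemma ocoordN i p : ocoord i (- p) = - ocoord i p.
Proof. by do 8?[case: i => [//|i]]; rewrite /ocoord /= !nth_nil oppr0. Qed.

Lemma ocoordZ i s p : ocoord i (s *: p) = s * ocoord i p.
Proof. by do 8?[case: i => [//|i]]; rewrite /ocoord /= !nth_nil mulr0. Qed.

Lemma ocoord0 i : ocoord i 0 = 0.
Proof. by do 8?[case: i => [//|i]]; rewrite /ocoord /= !nth_nil. Qed.

End OctonionAlgebra.

Lemma scale_regularE (R : realType) (s : R) (t : R^o) : s *: t = s * t.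
Proof. by []. Qed.

Ltac octs :=
  repeat match goal with p : oct _ |- _ =>
    case: p => [[[? ?] [? ?]] [[? ?] [? ?]]] end.
Ltac oct_ring :=
  intros; octs; do 3!congr CD; rewrite /= ?scale_regularE; ring.
Ltac ore_ring := intros; octs; rewrite /ore /= ?scale_regularE; ring.

Section OctonionIdentities.
Context {R : realType}.
Implicit Types (p q u x y : oct R) (s : R).

Lemma omulDl p q x : (p + q) *o x = p *o x + q *o x.
Proof. oct_ring. Qed.
Lemma omulDr p x y : p *o (x + y) = p *o x + p *o y.
Proof. oct_ring. Qed.
Lemma omulZl s p x : (s *: p) *o x = s *: (p *o x).
Proof. oct_ring. Qed.
Lemma omulZr s p x : p *o (s *: x) = s *: (p *o x).
Proof. oct_ring. Qed.
Lemma omul1o p : oreal 1 *o p = p.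
Proof. oct_ring. Qed.

(** With its three companions this is alternativity in the form used throughout: [p] next to its
    conjugate reassociates. [omul_polar] is the polarisation of this one. *)
Lemma omul_conjKl p x : p *o (oconj p *o x) = onormsq p *: x.
Proof. rewrite onormsq_coord; oct_ring. Qed.
Lemma omul_conjVKl p x : oconj p *o (p *o x) = onormsq p *: x.
Proof. rewrite onormsq_coord; oct_ring. Qed.
Lemma omul_conjKr p x : (x *o oconj p) *o p = onormsq p *: x.
Proof. rewrite onormsq_coord; oct_ring. Qed.
Lemma omul_conjVKr p x : (x *o p) *o oconj p = onormsq p *: x.
Proof. rewrite onormsq_coord; oct_ring. Qed.

Lemma oconjE p : oconj p = (2 * ore p) *: oreal 1 - p.
Proof. rewrite /ore; oct_ring. Qed.

Lemma omul_conj p : p *o oconj p = onormsq p *: oreal 1.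
Proof. rewrite onormsq_coord; oct_ring. Qed.

Lemma odotC p q : ore (p *o oconj q) = ore (q *o oconj p).
Proof. ore_ring. Qed.

(** Right multiplications by [u] and by its conjugate are adjoint for the Euclidean inner
    product. *)
Lemma ore_mul_conj p q u : ore (p *o oconj (q *o oconj u)) = ore ((p *o u) *o oconj q).
Proof. ore_ring. Qed.

Lemma omul_polar p q x : p *o (oconj q *o x) + q *o (oconj p *o x) =
  (2 * ore (p *o oconj q)) *: x.
Proof. rewrite /ore; oct_ring. Qed.

Lemma onormsq_sum p : onormsq p = \sum_(i < 8) ocoord i p ^+ 2.
Proof. by rewrite onormsq_coord !big_ord_recl big_ord0 addr0 !addrA. Qed.

Lemma onormsq_ge0 p : 0 <= onormsq p.
Proof. by rewrite onormsq_sum sumr_ge0 // => i _; rewrite sqr_ge0. Qed.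

Lemma onormsq_eq0 p : onormsq p = 0 -> p = 0.
Proof.
rewrite onormsq_sum => h; apply: oct_ext => i; rewrite ocoord0.
have [lti|gei] := ltnP i 8; last by rewrite /ocoord nth_default.
apply/eqP; rewrite -sqrf_eq0.
have /(_ _ (Ordinal lti) isT) /= -> // := psumr_eq0P _ h.
by move=> k _; rewrite sqr_ge0.
Qed.

End OctonionIdentities.

Set Implicit Arguments.
Unset Strict Implicit.

(* Over the concrete [oct R], failing unification unfolds products and sums down to
   real coordinates; hence the abstract carrier. The [ca_coord] fields only serve
   to decide linear identities by [ring]. *)
Record comp_algebra (R : realType) := CompAlgebra {
  ca_sort :> lmodType R;
  ca_mul : ca_sort -> ca_sort -> ca_sort;
  ca_one : ca_sort;
  ca_conj : ca_sort -> ca_sort;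
  ca_re : ca_sort -> R;
  ca_norm : ca_sort -> R;
  ca_coord : nat -> ca_sort -> R;
  ca_coordD : forall i p q, ca_coord i (p + q) = ca_coord i p + ca_coord i q;
  ca_coordN : forall i p, ca_coord i (- p) = - ca_coord i p;
  ca_coordZ : forall i s p, ca_coord i (s *: p) = s * ca_coord i p;
  ca_ext : forall p q, (forall i, ca_coord i p = ca_coord i q) -> p = q;
  ca_mulDl : forall p q x, ca_mul (p + q) x = ca_mul p x + ca_mul q x;
  ca_mulDr : forall p x y, ca_mul p (x + y) = ca_mul p x + ca_mul p y;
  ca_mulZl : forall s p x, ca_mul (s *: p) x = s *: ca_mul p x;
  ca_mulZr : forall s p x, ca_mul p (s *: x) = s *: ca_mul p x;
  ca_mul1l : forall x, ca_mul ca_one x = x;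
  ca_reD : forall p q, ca_re (p + q) = ca_re p + ca_re q;
  ca_reZ : forall s p, ca_re (s *: p) = s * ca_re p;
  ca_re1 : ca_re ca_one = 1;
  ca_conjE : forall p, ca_conj p = (2 * ca_re p) *: ca_one - p;
  ca_mul_conj : forall p, ca_mul p (ca_conj p) = ca_norm p *: ca_one;
  ca_norm_eq0 : forall p, ca_norm p = 0 -> p = 0;
  ca_dotC : forall p q, ca_re (ca_mul p (ca_conj q)) = ca_re (ca_mul q (ca_conj p));
  ca_conjKl : forall p x, ca_mul p (ca_mul (ca_conj p) x) = ca_norm p *: x;
  ca_conjVKl : forall p x, ca_mul (ca_conj p) (ca_mul p x) = ca_norm p *: x;
  ca_conjKr : forall p x, ca_mul (ca_mul x (ca_conj p)) p = ca_norm p *: x;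
  ca_conjVKr : forall p x, ca_mul (ca_mul x p) (ca_conj p) = ca_norm p *: x;
  ca_polar : forall p q x,
    ca_mul p (ca_mul (ca_conj q) x) + ca_mul q (ca_mul (ca_conj p) x)
    = (2 * ca_re (ca_mul p (ca_conj q))) *: x;
  ca_norm_ge0 : forall p, 0 <= ca_norm p;
  ca_dot_mulr : forall p q u, ca_re (ca_mul p (ca_conj (ca_mul q (ca_conj u))))
    = ca_re (ca_mul (ca_mul p u) (ca_conj q))
}.

Unset Implicit Arguments.
Set Strict Implicit.

Definition oct_comp_algebra (R : realType) : comp_algebra R :=
  @CompAlgebra R (oct R) omul (oreal 1) oconj ore onormsq ocoord
    ocoordD ocoordN ocoordZ oct_ext omulDl omulDr omulZl omulZr omul1o
    (fun _ _ => erefl) (fun _ _ => erefl) erefl oconjE omul_conj onormsq_eq0 odotC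
    omul_conjKl omul_conjVKl omul_conjKr omul_conjVKr omul_polar
    onormsq_ge0 ore_mul_conj.

Notation "p ** q" := (ca_mul p q) (at level 40, left associativity).

Ltac ca_module :=
  apply: ca_ext => ?; rewrite !(ca_coordD, ca_coordN, ca_coordZ);
  repeat match goal with |- context [ca_coord ?j ?p] =>
    generalize (ca_coord j p); intro end;
  ring.

(** * Inner product, imaginary parts and the Clifford relations of left multiplications *)

Section QuaternionicFrames.
Context {R : realType} {O : comp_algebra R}.
Implicit Types (p q u w x y a b c i j k : O) (d e f g s t : R).

Lemma ca_mulNl p x : (- p) ** x = - (p ** x).
Proof. by rewrite -scaleN1r ca_mulZl scaleN1r. Qed.
Lemma ca_mulNr p x : p ** (- x) = - (p ** x).
Proof. by rewrite -scaleN1r ca_mulZr scaleN1r. Qed.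
Lemma ca_mul0l x : 0 ** x = 0 :> O.
Proof. by rewrite -(scale0r 0) ca_mulZl !scale0r. Qed.
Lemma ca_mul0r p : p ** 0 = 0 :> O.
Proof. by rewrite -(scale0r 0) ca_mulZr !scale0r. Qed.
Lemma ca_reN p : ca_re (- p) = - ca_re p.
Proof. by rewrite -scaleN1r ca_reZ mulN1r. Qed.
Lemma ca_re0 : ca_re (0 : O) = 0.
Proof. by rewrite -(scale0r 0) ca_reZ mul0r. Qed.
Lemma ca_conj0 : ca_conj (0 : O) = 0.
Proof. by rewrite ca_conjE ca_re0 mulr0 scale0r subr0. Qed.

Definition dot p q : R := ca_re (p ** ca_conj q).

Lemma dotC p q : dot p q = dot q p. Proof. exact: ca_dotC. Qed.
Lemma dotDl p q x : dot (p + q) x = dot p x + dot q x.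
Proof. by rewrite /dot ca_mulDl ca_reD. Qed.
Lemma dotZl s p x : dot (s *: p) x = s * dot p x.
Proof. by rewrite /dot ca_mulZl ca_reZ. Qed.
Lemma dot_self p : dot p p = ca_norm p.
Proof. by rewrite /dot ca_mul_conj ca_reZ ca_re1 mulr1. Qed.
Lemma dot1l p : dot (ca_one O) p = ca_re p.
Proof. by rewrite /dot ca_mul1l ca_conjE ca_reD ca_reN ca_reZ ca_re1; ring. Qed.

Definition oim p : O := p - ca_re p *: ca_one O.

Lemma ca_re_oim p : ca_re (oim p) = 0.
Proof. by rewrite /oim ca_reD ca_reN ca_reZ ca_re1 mulr1 subrr. Qed.
Lemma oim_id p : ca_re p = 0 -> oim p = p.
Proof. by rewrite /oim => ->; rewrite scale0r subr0. Qed.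
Lemma oimE p : p = ca_re p *: ca_one O + oim p.
Proof. by rewrite /oim addrC subrK. Qed.
Lemma ca_conj_oimE p : ca_conj p = ca_re p *: ca_one O - oim p.
Proof. by rewrite ca_conjE /oim; ca_module. Qed.
Lemma ca_conj_oim p : ca_conj (oim p) = - oim p.
Proof. by rewrite ca_conjE ca_re_oim mulr0 scale0r sub0r. Qed.

(** Conjugation is negation on imaginary elements, which turns [ca_polar] into the Clifford
    relation. *)
Lemma oim_anticomm p q x :
  oim p ** (oim q ** x) = - (oim q ** (oim p ** x)) - (2 * dot (oim p) (oim q)) *: x.
Proof.
have := ca_polar (oim p) (oim q) x; rewrite -/(dot _ _) => <-.
by rewrite !ca_conj_oim !ca_mulNl !ca_mulNr opprD !opprK addrC addrK.
Qed.

Lemma imag_anticomm p q x : ca_re p = 0 -> ca_re q = 0 -> dot p q = 0 ->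
  p ** (q ** x) = - (q ** (p ** x)).
Proof.
move=> hp hq h; have := oim_anticomm p q x.
by rewrite !oim_id // h mulr0 scale0r subr0.
Qed.

Lemma imag_sq p x : ca_re p = 0 -> p ** (p ** x) = - ca_norm p *: x.
Proof.
move=> hp; have := ca_conj_oimE p; rewrite hp scale0r sub0r oim_id // => hc.
by rewrite scaleNr -ca_conjKl hc ca_mulNl ca_mulNr opprK.
Qed.

(** * Triple left multiplications and their quaternionic eigenspaces *)

Definition triple i j k x : O := i ** (j ** (k ** x)).

Definition ortho_imag i j k : Prop :=
  [/\ ca_re i = 0, ca_re j = 0 & ca_re k = 0] /\
  [/\ dot i j = 0, dot j k = 0 & dot k i = 0].

Lemma ortho_imag_cyc i j k : ortho_imag i j k -> ortho_imag j k i.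
Proof. by case=> [[hi hj hk] [hij hjk hki]]. Qed.

(** Moving [i] to the front past [k] and [j] costs two signs. *)
Lemma triple_cyc i j k x : ortho_imag i j k -> triple j k i x = triple i j k x.
Proof.
case=> [[hi hj hk] [hij hjk hki]]; rewrite /triple.
rewrite (imag_anticomm k) // ca_mulNr (imag_anticomm j) ?opprK //.
by rewrite dotC.
Qed.

Lemma tripleD i j k x y : triple i j k (x + y) = triple i j k x + triple i j k y.
Proof. by rewrite /triple !ca_mulDr. Qed.
Lemma tripleZ i j k s x : triple i j k (s *: x) = s *: triple i j k x.
Proof. by rewrite /triple !ca_mulZr. Qed.

Lemma triple_sq i j k x : ortho_imag i j k ->
  triple i j k (triple i j k x) = (ca_norm i * ca_norm j * ca_norm k) *: x.
Proof.
move=> h; case: (h) => [[hi hj hk] [hij hjk hki]].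
(* Cycling the outer triple to [triple j k i] makes the two factors [i] adjacent. *)
rewrite -(triple_cyc _ _ _ (triple i j k x)) // /triple (imag_sq i) // !ca_mulZr.
rewrite (imag_anticomm k j) // 1?dotC // ca_mulNr imag_sq // imag_sq //.
by rewrite -scaleNr !scalerA; congr (_ *: _); ring.
Qed.

(** Both sides are [i] applied to [triple j k i x], up to cyclic invariance. *)
Lemma triple_comm i j k x : ortho_imag i j k ->
  triple i j k (i ** x) = i ** triple i j k x.
Proof. by move=> h; rewrite -(triple_cyc i j k x) // -(triple_cyc j k i x). Qed.

(** Passing [p] through three anticommuting factors leaves one sign. *)
Lemma triple_anticomm i j k p x : ortho_imag i j k -> ca_re p = 0 ->
    dot p i = 0 -> dot p j = 0 -> dot p k = 0 ->
  triple i j k (p ** x) = - (p ** triple i j k x).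
Proof.
move=> [[hi hj hk] _] hp pi pj pk; rewrite /triple.
rewrite (imag_anticomm k) // 1?dotC // ca_mulNr (imag_anticomm j) // 1?dotC //.
by rewrite opprK (imag_anticomm i) // dotC.
Qed.

(* On the [g]-eigenspace of [triple i j k], left multiplications by [i], [j], [k]
   generate a quaternion algebra. *)
Definition quat_frame i j k g : Prop :=
  [/\ ortho_imag i j k, g != 0 & g ^+ 2 = ca_norm i * ca_norm j * ca_norm k].

Definition eigen i j k g x : Prop := triple i j k x = g *: x.

(** Only a linear span: its elements multiply like quaternions through their action on an
    eigenspace, not as octonions. *)
Definition qspan i j k p : Prop :=
  exists t s1 s2 s3, p = t *: ca_one O + s1 *: i + s2 *: j + s3 *: k.

Lemma quat_frame_cyc i j k g : quat_frame i j k g -> quat_frame j k i g.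
Proof.
case=> h hg hn; split=> //; first exact: ortho_imag_cyc.
by rewrite hn; ring.
Qed.

Lemma eigen_cyc i j k g x : quat_frame i j k g -> eigen i j k g x -> eigen j k i g x.
Proof. by case=> h _ _; rewrite /eigen (triple_cyc i). Qed.

Lemma qspan_real i j k s : qspan i j k (s *: ca_one O).
Proof. by exists s, 0, 0, 0; rewrite !scale0r !addr0. Qed.

Lemma frame_norm_neq0 i j k g : quat_frame i j k g -> ca_norm i != 0.
Proof.
case=> _ hg hn; apply: contraNneq hg => h.
by rewrite -sqrf_eq0 hn h !mul0r.
Qed.

Lemma eigenD i j k g x y : eigen i j k g x -> eigen i j k g y -> eigen i j k g (x + y).
Proof. by rewrite /eigen tripleD scalerDr => -> ->. Qed.

Lemma eigenZ i j k g s x : eigen i j k g x -> eigen i j k g (s *: x).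
Proof. by rewrite /eigen tripleZ => ->; rewrite !scalerA mulrC. Qed.

Lemma eigen_mull i j k g x : quat_frame i j k g ->
  eigen i j k g x -> eigen i j k g (i ** x).
Proof. by case=> h _ _ e; rewrite /eigen triple_comm // e ca_mulZr. Qed.

Lemma eigen_qspan i j k g p x : quat_frame i j k g ->
  qspan i j k p -> eigen i j k g x -> eigen i j k g (p ** x).
Proof.
move=> h [t [s1 [s2 [s3 ->]]]] e; rewrite !ca_mulDl !ca_mulZl ca_mul1l.
have h' := quat_frame_cyc _ _ _ _ h; have h'' := quat_frame_cyc _ _ _ _ h'.
apply: eigenD; first (apply: eigenD; first apply: eigenD); apply: eigenZ => //.
- exact: eigen_mull.
- apply: (eigen_cyc k i j) => //; apply: (eigen_cyc j k i) => //.
  by apply: eigen_mull => //; apply: eigen_cyc.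
- by apply: (eigen_cyc k i j) => //; apply: eigen_mull => //;
    apply: eigen_cyc => //; apply: eigen_cyc.
Qed.

(** Apply [i] to the eigenvector equation and use that the square of [i] is minus its norm. *)
Lemma eigen_mulij i j k g x : quat_frame i j k g -> eigen i j k g x ->
  j ** (k ** x) = - (g / ca_norm i) *: (i ** x).
Proof.
move=> h e; have ni := frame_norm_neq0 _ _ _ _ h; case: h => [[[hi _ _] _] _ _].
have := imag_sq i (j ** (k ** x)) hi; rewrite -/(triple i j k x) e ca_mulZr => e'.
have ni' : - ca_norm i != 0 by rewrite oppr_eq0.
by apply: (scalerI ni'); rewrite -e' scalerA mulrNN mulrC divfK.
Qed.

Lemma qspan_mul i j k g q : quat_frame i j k g -> qspan i j k q ->
  exists2 r, qspan i j k r & forall x, eigen i j k g x -> i ** (q ** x) = r ** x.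
Proof.
move=> h [t [s1 [s2 [s3 ->]]]].
have h' := quat_frame_cyc _ _ _ _ h; have h'' := quat_frame_cyc _ _ _ _ h'.
(* On the eigenspace [i] times [i], [j], [k] acts as [- ca_norm i], [- (g / ca_norm k)] times [k]
   and [g / ca_norm j] times [j], by [eigen_mulij] and its cyclic forms. *)
exists (- (s1 * ca_norm i) *: ca_one O + t *: i + (s3 * (g / ca_norm j)) *: j
   + - (s2 * (g / ca_norm k)) *: k) => [|x e]; first by do 4!eexists.
have e' := eigen_cyc _ _ _ _ _ h e; have e'' := eigen_cyc _ _ _ _ _ h' e'.
case: (h) => [[[hi hj hk] [hij hjk hki]] _ _].
rewrite !(ca_mulDl, ca_mulZl, ca_mulDr, ca_mulZr, ca_mul1l).
rewrite imag_sq // (imag_anticomm i k) // 1?dotC //.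
rewrite (eigen_mulij k i j g) // (eigen_mulij j k i g) //.
ca_module.
Qed.

(* The component of [u w^-] orthogonal to the span anticommutes with the triple,
   so it sends [w] to the opposite eigenspace. *)
Lemma qspan_of_eigen i j k g u w : quat_frame i j k g ->
  eigen i j k g u -> eigen i j k g w -> qspan i j k (u ** ca_conj w).
Proof.
move=> h eu ew.
have h' := quat_frame_cyc _ _ _ _ h; have h'' := quat_frame_cyc _ _ _ _ h'.
have ni := frame_norm_neq0 _ _ _ _ h; have nj := frame_norm_neq0 _ _ _ _ h'.
have nk := frame_norm_neq0 _ _ _ _ h''.
have qw : (u ** ca_conj w) ** w = ca_norm w *: u by rewrite ca_conjKr.
have [-> |w0] := eqVneq w 0.
  by exists 0, 0, 0, 0; rewrite !scale0r !addr0 ca_conj0 ca_mul0r.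
set q := u ** ca_conj w in qw *.
(* [m] is the orthogonal projection of [q] onto the span. *)
set m := ca_re q *: ca_one O + (dot q i / ca_norm i) *: i
  + (dot q j / ca_norm j) *: j + (dot q k / ca_norm k) *: k.
have mspan : qspan i j k m by do 4!eexists.
suff n0 : q - m = 0 by rewrite (subr0_eq n0).
case: (h) => [hor hg _]; case: (hor) => [[hi hj hk] [hij hjk hki]].
have enw : eigen i j k g ((q - m) ** w).
  rewrite ca_mulDl ca_mulNl qw -scaleN1r; apply: eigenD; apply: eigenZ => //.
  exact: eigen_qspan.
have dot p : dot (q - m) p = dot q p - ca_re q * ca_re p
    - dot q i / ca_norm i * dot i p - dot q j / ca_norm j * dot j p
    - dot q k / ca_norm k * dot k p.
  by rewrite /m dotDl -scaleN1r !(dotZl, dotDl) dot1l; ring.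
have : triple i j k ((q - m) ** w) = - ((q - m) ** triple i j k w).
  apply: triple_anticomm => //.
  - rewrite ca_reD ca_reN !ca_reD !ca_reZ hi hj hk /= !mulr0 !addr0.
    by rewrite ca_re1 mulr1 subrr.
  - by rewrite dot hi dot_self (dotC j) hij hki divfK //; ring.
  - by rewrite dot hj dot_self hij (dotC k) hjk divfK //; ring.
  - by rewrite dot hk dot_self hjk (dotC i) hki divfK //; ring.
(* [(q - m) ** w] is thus an eigenvector for both [g] and [- g], hence zero; multiplying by the
   conjugate of [w] on the right then kills [q - m]. *)
rewrite enw ew ca_mulZr => /eqP; rewrite -subr_eq0 opprK -scalerDl scaler_eq0.
rewrite -mulr2n mulrn_eq0 (negbTE hg) /= => /eqP nw0.
apply/eqP; have := ca_conjVKr w (q - m); rewrite nw0 ca_mul0l => /esym/eqP.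
rewrite scaler_eq0; case/orP=> // /eqP /ca_norm_eq0 w00.
by rewrite w00 eqxx in w0.
Qed.

Lemma eigen_assoc1 i j k g u w y : quat_frame i j k g ->
    eigen i j k g u -> eigen i j k g w -> eigen i j k g y ->
  i ** ((u ** ca_conj w) ** y) = ((i ** u) ** ca_conj w) ** y.
Proof.
move=> h eu ew ey.
(* The left side acts on eigenvectors as one multiplier [r]; evaluation at [w] identifies [r] with
   [(i ** u) ** ca_conj w]. *)
have [r _ hr] := qspan_mul _ _ _ _ _ h (qspan_of_eigen _ _ _ _ _ _ h eu ew).
rewrite hr //; have := hr w ew; rewrite ca_conjKr ca_mulZr => e.
have [w0|nw0] := eqVneq (ca_norm w) 0; last first.
  congr (_ ** _); apply: (scalerI nw0).
  by rewrite -[LHS]ca_conjVKr -e ca_mulZl.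
by rewrite -hr // (ca_norm_eq0 w0) ca_conj0 !ca_mul0r !ca_mul0l ca_mul0r.
Qed.

(** Both sides are linear in [p], and [j] and [k] reduce to the case of [i] by cyclic symmetry. *)
Lemma eigen_assoc i j k g p u w y : quat_frame i j k g -> qspan i j k p ->
    eigen i j k g u -> eigen i j k g w -> eigen i j k g y ->
  p ** ((u ** ca_conj w) ** y) = ((p ** u) ** ca_conj w) ** y.
Proof.
move=> h [t [s1 [s2 [s3 ->]]]] eu ew ey.
have h' := quat_frame_cyc _ _ _ _ h; have h'' := quat_frame_cyc _ _ _ _ h'.
have cyc x : eigen i j k g x -> eigen j k i g x by exact: eigen_cyc.
have cyc' x : eigen i j k g x -> eigen k i j g x by move/cyc; exact: eigen_cyc.
have ei := eigen_assoc1 i j k g u w y h eu ew ey.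
have ej := eigen_assoc1 j k i g u w y h' (cyc _ eu) (cyc _ ew) (cyc _ ey).
have ek := eigen_assoc1 k i j g u w y h'' (cyc' _ eu) (cyc' _ ew) (cyc' _ ey).
by rewrite !(ca_mulDl, ca_mulZl) !ca_mul1l ei ej ek.
Qed.

Lemma qspan_conj i j k p : qspan i j k p -> qspan i j k (ca_conj p).
Proof.
case=> t [s1 [s2 [s3 e]]].
exists (2 * ca_re p - t), (- s1), (- s2), (- s3).
by rewrite ca_conjE {2}e; ca_module.
Qed.

(** * The antisymmetrised triple multiplication and its orthogonal form *)

Definition cross a c b x : O :=
  oim a ** (oim c ** (oim b ** x)) - oim b ** (oim c ** (oim a ** x)).

(** The inner-product terms of the Clifford relations cancel. This lets all three matrix rows
    produce the same map. *)
Lemma cross_cyc a c b x : cross c b a x = cross a c b x.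
Proof.
rewrite /cross; move: (oim_anticomm c a) (oim_anticomm b a) (oim_anticomm c b).
move: (oim a) (oim b) (oim c) => {}a {}b {}c ca ba cb.
rewrite (ba x) (ca x) !(ca_mulDr, ca_mulNr, ca_mulZr) (ca (b ** x)) (ba (c ** x)).
rewrite (cb x) !(ca_mulDr, ca_mulNr, ca_mulZr).
ca_module.
Qed.

(* The projection coefficient onto [p = 0] is the junk value [0], as wanted. *)
Lemma dot_sub_proj p q : dot (q - (dot q p / dot p p) *: p) p = 0.
Proof.
rewrite -scaleNr dotDl dotZl.
have [p0|np0] := eqVneq (dot p p) 0; last by rewrite mulNr divfK ?subrr.
rewrite p0 mulr0 addr0.
by move: p0; rewrite dot_self => /ca_norm_eq0 ->; rewrite dotC -(scale0r 0) dotZl mul0r.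
Qed.

(** [cross] is alternating in its factors, so the triangular corrections drop out; reversing an
    orthogonal triple changes its sign, whence the factor 2. *)
Lemma cross_frame a b c i j k s t d x : ortho_imag i j k ->
    oim a = i -> oim c = s *: i + j -> oim b = t *: i + d *: j + k ->
  cross a c b x = 2 *: triple i j k x.
Proof.
move=> [[hi hj hk] [hij hjk hki]] ea ec eb; rewrite /cross /triple ea ec eb.
have ji y : j ** (i ** y) = - (i ** (j ** y)) by rewrite imag_anticomm // dotC.
have ki y : k ** (i ** y) = - (i ** (k ** y)) by rewrite imag_anticomm.
have kj y : k ** (j ** y) = - (j ** (k ** y)) by rewrite imag_anticomm // dotC.
have i2 y := imag_sq i y hi; have j2 y := imag_sq j y hj.
rewrite !(ca_mulDl, ca_mulDr, ca_mulZl, ca_mulZr).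
rewrite !(i2, j2, ji, ki, kj, ca_mulNr, ca_mulZr).
ca_module.
Qed.

(** The process runs in the order [a], [c], [b] of the factors of [cross]. Some of [i], [j], [k] may
    vanish. *)
Lemma gram_schmidt a b c : exists i j k,
  [/\ ortho_imag i j k, [/\ qspan i j k a, qspan i j k b & qspan i j k c]
    & forall x, cross a c b x = 2 *: triple i j k x].
Proof.
pose i := oim a; pose s := dot (oim c) i / dot i i; pose j := oim c - s *: i.
pose t := dot (oim b) i / dot i i; pose b' := oim b - t *: i.
pose w := dot b' j / dot j j; pose k := b' - w *: j.
have hi : ca_re i = 0 by rewrite ca_re_oim.
have hj : ca_re j = 0 by rewrite ca_reD ca_reN ca_reZ ca_re_oim hi mulr0 subrr.
have hk : ca_re k = 0.
  by rewrite ca_reD ca_reN ca_reZ hj ca_reD ca_reN ca_reZ ca_re_oim hi !mulr0 !subrr.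
have ji : dot j i = 0 by exact: dot_sub_proj.
have kj : dot k j = 0 by exact: dot_sub_proj.
have ki : dot k i = 0.
  by rewrite /k -scaleNr dotDl dotZl ji mulr0 addr0; exact: dot_sub_proj.
have hor : ortho_imag i j k by do 2!split=> //; rewrite dotC.
have cE : oim c = s *: i + j by rewrite /j; ca_module.
have bE : oim b = t *: i + w *: j + k by rewrite /k /b'; ca_module.
exists i, j, k; split=> [//||x].
  split.
  - exists (ca_re a), 1, 0, 0; rewrite {1}(oimE a) -/i; ca_module.
  - exists (ca_re b), t, w, 1; rewrite {1}(oimE b) bE; ca_module.
  - exists (ca_re c), s, 1, 0; rewrite {1}(oimE c) cE; ca_module.
exact: (cross_frame _ _ _ i j k s t w).
Qed.

(** * The characteristic polynomial, row by row *)

Definition cross_shift a b c : R :=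
  2 * (ca_re a * ca_re b * ca_re c - ca_re a * dot (oim b) (oim c)
       - ca_re b * dot (oim a) (oim c) - ca_re c * dot (oim a) (oim b)).

(** Split each factor into real and imaginary part: the terms linear in imaginary parts cancel, the
    quadratic ones pair into inner products, and the cubic ones form [cross]. *)
Lemma cross_shiftE a b c x :
  a ** (c ** (b ** x)) + ca_conj b ** (ca_conj c ** (ca_conj a ** x)) =
  cross a c b x + cross_shift a b c *: x.
Proof.
rewrite /cross /cross_shift {1}(oimE a) {1}(oimE b) {1}(oimE c) !ca_conj_oimE.
move: (oim_anticomm a b x) (oim_anticomm b c x) (oim_anticomm a c x).
move: (oim a) (oim b) (oim c) (ca_re a) (ca_re b) (ca_re c).
move=> {}a {}b {}c r s t ab bc ac.
rewrite !(ca_mulDl, ca_mulDr, ca_mulNl, ca_mulNr, ca_mulZl, ca_mulZr, ca_mul1l).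
rewrite ab bc ac; ca_module.
Qed.

Lemma cross_shift_cyc a b c : cross_shift c a b = cross_shift a b c.
Proof. by rewrite /cross_shift (dotC (oim c) (oim b)) (dotC (oim c) (oim a)); ring. Qed.

(** As for Cayley-Hamilton, all terms cancel by alternativity except the two off-diagonal 3-cycles
    through the row index, which [cross_shiftE] evaluates. Here [s] stands for the term
    [2 Re(b(ac))] of the determinant. *)
Lemma char_rows d e f s a b c x0 x1 x2 :
  let row0 y0 y1 y2 := d *: y0 + a ** y1 + ca_conj b ** y2 in
  let row1 y0 y1 y2 := ca_conj a ** y0 + e *: y1 + c ** y2 in
  let row2 y0 y1 y2 := b ** y0 + ca_conj c ** y1 + f *: y2 in
  let y0 := row0 x0 x1 x2 in let y1 := row1 x0 x1 x2 in let y2 := row2 x0 x1 x2 in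
  let z0 := row0 y0 y1 y2 in let z1 := row1 y0 y1 y2 in let z2 := row2 y0 y1 y2 in
  let char w z y x := w - (d + e + f) *: z
    + (d * e + d * f + e * f - (ca_norm a + ca_norm b + ca_norm c)) *: y
    - (d * e * f + s - d * ca_norm c - e * ca_norm b - f * ca_norm a) *: x in
  let k x := cross a c b x + (cross_shift a b c - s) *: x in
  [/\ char (row0 z0 z1 z2) z0 y0 x0 = k x0,
      char (row1 z0 z1 z2) z1 y1 x1 = k x1
    & char (row2 z0 z1 z2) z2 y2 x2 = k x2].
Proof.
split.
- have /esym /(canRL (addrK _)) -> /= := cross_shiftE a b c x0.
  rewrite !(ca_mulDr, ca_mulZr, ca_conjKl, ca_conjVKl).
  move: (cross_shift a b c) => r; ca_module.
(* The cycles through the second index start with [c], so the formula is needed in cyclically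
   shifted form. *)
- rewrite -cross_cyc -cross_shift_cyc.
  have /esym /(canRL (addrK _)) -> /= := cross_shiftE c a b x1.
  rewrite !(ca_mulDr, ca_mulZr, ca_conjKl, ca_conjVKl).
  move: (cross_shift c a b) => r; ca_module.
- rewrite -2!cross_cyc -2!cross_shift_cyc.
  have /esym /(canRL (addrK _)) -> /= := cross_shiftE b c a x2.
  rewrite !(ca_mulDr, ca_mulZr, ca_conjKl, ca_conjVKl).
  move: (cross_shift b c a) => r; ca_module.
Qed.

(** * Eigenspaces of [cross]: associativity and projections *)

Lemma crossD a c b x y : cross a c b (x + y) = cross a c b x + cross a c b y.
Proof. by rewrite /cross !ca_mulDr; ca_module. Qed.
Lemma crossZ a c b s x : cross a c b (s *: x) = s *: cross a c b x.
Proof. by rewrite /cross !ca_mulZr; ca_module. Qed.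

(** The square of [cross] is a scalar by [triple_sq], so one nonzero eigenvector determines it. *)
Lemma cross_sq a c b g w : w != 0 -> cross a c b w = g *: w ->
  forall x, cross a c b (cross a c b x) = g ^+ 2 *: x.
Proof.
have [i [j [k [h _ hc]]]] := gram_schmidt a b c.
have sq x : cross a c b (cross a c b x)
    = (4 * (ca_norm i * ca_norm j * ca_norm k)) *: x.
  rewrite !hc tripleZ triple_sq // !scalerA; congr (_ *: _); ring.
move=> w0 ew x; have := sq w; rewrite ew crossZ ew scalerA => /eqP.
rewrite -subr_eq0 -scalerBl scaler_eq0 (negbTE w0) orbF subr_eq0 => /eqP e.
by rewrite sq -e expr2.
Qed.

(** Quantifying over all triples makes this independent of the one that [gram_schmidt] produces. *)
Definition frame_spanned a b c p : Prop := forall i j k,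
  qspan i j k a -> qspan i j k b -> qspan i j k c -> qspan i j k p.

Lemma cross_assoc a c b g p u w y : g != 0 -> frame_spanned a b c p ->
    cross a c b u = g *: u -> cross a c b w = g *: w -> cross a c b y = g *: y ->
  p ** ((u ** ca_conj w) ** y) = ((p ** u) ** ca_conj w) ** y.
Proof.
move=> g0 hp eu ew ey.
have [->|w0] := eqVneq w 0.
  by rewrite ca_conj0 !ca_mul0r !ca_mul0l ca_mul0r.
have [i [j [k [h [ha hb hc] hcr]]]] := gram_schmidt a b c.
have n2 : (2 : R) != 0 by rewrite pnatr_eq0.
have eig x : cross a c b x = g *: x -> eigen i j k (g / 2) x.
  rewrite hcr /eigen => e; apply: (scalerI n2).
  by rewrite e scalerA mulrC divfK.
apply: (eigen_assoc i j k (g / 2)); try exact: eig; last exact: hp.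
split=> //; first by rewrite mulf_neq0 // invr_eq0.
(* The nonzero eigenvector [w] forces [(g / 2) ^+ 2] to equal the product of the three norms. *)
have e := eig _ ew; have := triple_sq i j k w h; rewrite e tripleZ e scalerA => /eqP.
rewrite -subr_eq0 -scalerBl scaler_eq0 (negbTE w0) orbF subr_eq0 => /eqP <-.
by rewrite expr2.
Qed.

Lemma ca_mul_sumr I (s : seq I) p (F : I -> O) :
  p ** (\sum_(l <- s) F l) = \sum_(l <- s) p ** F l.
Proof. by elim/big_rec2: _ => [|l y x _ <-]; rewrite ?ca_mul0r ?ca_mulDr. Qed.
Lemma ca_mul_suml I (s : seq I) x (F : I -> O) :
  (\sum_(l <- s) F l) ** x = \sum_(l <- s) F l ** x.
Proof. by elim/big_rec2: _ => [|l y z _ <-]; rewrite ?ca_mul0l ?ca_mulDl. Qed.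
Lemma dot_suml I (s : seq I) x (F : I -> O) :
  dot (\sum_(l <- s) F l) x = \sum_(l <- s) dot (F l) x.
Proof.
elim/big_rec2: _ => [|l y z _ <-]; last by rewrite dotDl.
by rewrite -(scale0r 0) dotZl mul0r.
Qed.

(** One row of A((v v^+) y) = ((A v) v^+) y, with [M] that row of A. *)
Lemma cross_outer_assoc a c b g n (M v y : 'I_n -> O) : g != 0 ->
    (forall l, frame_spanned a b c (M l)) ->
    (forall l, cross a c b (v l) = g *: v l) ->
    (forall l, cross a c b (y l) = g *: y l) ->
  \sum_l M l ** (\sum_k (v l ** ca_conj (v k)) ** y k)
  = \sum_k ((\sum_l M l ** v l) ** ca_conj (v k)) ** y k.
Proof.
move=> g0 hM hv hy; under eq_bigr do rewrite ca_mul_sumr.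
rewrite exchange_big; apply: eq_bigr => k _ /=; rewrite !ca_mul_suml.
by apply: eq_bigr => l _; apply: (cross_assoc a c b g).
Qed.

Lemma cross_outer_eigen a b c g n (M v y : 'I_n -> O) s (l : 'I_n) : g != 0 ->
    (forall k : 'I_n, frame_spanned a b c (M k)) ->
    (forall k : 'I_n, cross a c b (v k) = g *: v k) ->
    (forall k : 'I_n, cross a c b (y k) = g *: y k) ->
    \sum_(k < n) M k ** v k = s *: v l ->
  \sum_(k < n) M k ** (\sum_(h < n) (v k ** ca_conj (v h)) ** y h)
  = s *: \sum_(h < n) (v l ** ca_conj (v h)) ** y h.
Proof.
move=> g0 hM hv hy e; rewrite (cross_outer_assoc a c b g) // e scaler_sumr.
by apply: eq_bigr => k _; rewrite !ca_mulZl.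
Qed.

Lemma cross_sq_unit a c b g n (v : 'I_n -> O) : \sum_(k < n) ca_norm (v k) = 1 ->
    (forall k : 'I_n, cross a c b (v k) = g *: v k) ->
  forall x, cross a c b (cross a c b x) = g ^+ 2 *: x.
Proof.
move=> v1 ev; case: (pickP (fun k : 'I_n => v k != 0)) => [k nz|v0].
  exact: (cross_sq _ _ _ _ _ nz (ev k)).
have : \sum_(k < n) ca_norm (v k) = 0.
  apply: big1 => k _; move/negbFE/eqP: (v0 k) => ->.
  by rewrite -dot_self -{1}(scale0r 0) dotZl mul0r.
by rewrite v1 => /eqP; rewrite oner_eq0.
Qed.

(** With T = [cross], T^2 = g^2 gives (T - g)(T + g) = 0. *)
Lemma cross_proj a c b g x :
    (forall x, cross a c b (cross a c b x) = g ^+ 2 *: x) ->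
  let y := (2 * g)^-1 *: (cross a c b x + g *: x) in cross a c b y = g *: y.
Proof.
move=> h /=; move: (_^-1) => t; rewrite crossZ crossD crossZ h; ca_module.
Qed.

Lemma proj_sum g (x y : O) : g != 0 ->
  x = (2 * g)^-1 *: (y + g *: x) + (2 * - g)^-1 *: (y + - g *: x).
Proof.
move=> g0; rewrite mulrN invrN scaleNr -scalerBr.
have -> : y + g *: x - (y + - g *: x) = (2 * g) *: x by ca_module.
by rewrite scalerA mulVf ?scale1r // mulf_neq0 // pnatr_eq0.
Qed.

End QuaternionicFrames.

(** * Resolution of the identity by an orthonormal family *)

Section Resolution.
Context {R : realType} {O : comp_algebra R}.

(* [N = \sum_j v_j v_j^+ - 1] kills every [v_j] and has trace [0], hence it is
   orthogonal to every [v_j v_j^+] and to [1], i.e. to itself. *)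
Lemma orthonormal_resolution n (v : 'I_n -> 'I_n -> O) :
    (forall j, \sum_k ca_norm (v j k) = 1) ->
    (forall i j, i != j -> forall l, \sum_k (v i l ** ca_conj (v i k)) ** v j k = 0) ->
  forall l k, \sum_j v j l ** ca_conj (v j k) = (l == k)%:R *: ca_one O.
Proof.
move=> hn ho l0 k0.
pose N l k := \sum_j v j l ** ca_conj (v j k) - (l == k)%:R *: ca_one O.
have Nv j l : \sum_k N l k ** v j k = 0.
  under eq_bigr do rewrite /N ca_mulDl ca_mul_suml ca_mulNl ca_mulZl ca_mul1l.
  rewrite big_split /= exchange_big /= (bigD1 j) //= [X in _ + X + _]big1 ?addr0; last first.
    by move=> i ij; apply: ho.
  under eq_bigr do rewrite ca_conjKr.
  rewrite -scaler_suml hn scale1r (bigD1 l) //= big1 => [|k kl].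
    by rewrite eqxx scale1r addr0 subrr.
  by rewrite eq_sym (negbTE kl) scale0r oppr0.
have trN : \sum_l ca_re (N l l) = 0.
  under eq_bigr do rewrite /N -dot1l dotC dotDl dot_suml -scaleNr dotZl.
  rewrite big_split /= exchange_big /=.
  under eq_bigr do under eq_bigr do rewrite dotC dot1l -/(dot _ _) dot_self.
  under eq_bigr do rewrite hn.
  under [X in _ + X]eq_bigr do rewrite eqxx dot_self -dot_self dot1l ca_re1 mulr1.
  by rewrite -big_split /= big1 // => i _; rewrite subrr.
have NN : \sum_l \sum_k ca_norm (N l k) = 0.
  (* One factor of <N, N> is expanded by its definition, and the conjugated coordinate is moved to
     the other side by adjointness, so that [Nv] applies. *)
  transitivity (\sum_l \sum_k (\sum_j dot (N l k ** v j k) (v j l)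
      - (l == k)%:R * ca_re (N l k))).
    apply: eq_bigr => l _; apply: eq_bigr => k _.
    rewrite -dot_self {2}/N dotC dotDl dot_suml -scaleNr dotZl dot1l mulNr.
    congr (_ - _); apply: eq_bigr => j _.
    by rewrite dotC /dot ca_dot_mulr.
  under eq_bigr do rewrite big_split /= exchange_big /=.
  rewrite big_split /= big1 ?add0r => [|l _]; last first.
    rewrite big1 // => j _.
    by rewrite -dot_suml Nv -(scale0r 0) dotZl mul0r.
  transitivity (- \sum_l ca_re (N l l)); last by rewrite trN oppr0.
  rewrite -sumrN; apply: eq_bigr => l _.
  rewrite (bigD1 l) //= big1 => [|k kl]; first by rewrite eqxx mul1r addr0.
  by rewrite eq_sym (negbTE kl) mul0r oppr0.
have ge0 l k : 0 <= ca_norm (N l k) by exact: ca_norm_ge0.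
have /(_ l0 isT) Nl := psumr_eq0P (fun l _ => sumr_ge0 _ (fun k _ => ge0 l k)) NN.
have /(_ k0 isT) := psumr_eq0P (fun k _ => ge0 l0 k) Nl.
by move=> /ca_norm_eq0 /subr0_eq.
Qed.

Lemma orthonormal_resolution_mul n (v : 'I_n -> 'I_n -> O) (y : 'I_n -> O) l :
    (forall j, \sum_k ca_norm (v j k) = 1) ->
    (forall i j, i != j -> forall l, \sum_k (v i l ** ca_conj (v i k)) ** v j k = 0) ->
  \sum_j \sum_k (v j l ** ca_conj (v j k)) ** y k = y l.
Proof.
move=> hn ho; rewrite exchange_big /=.
under eq_bigr do rewrite -ca_mul_suml (orthonormal_resolution _ v hn ho).
rewrite (bigD1 l) //= big1 => [|k kl].
  by rewrite eqxx scale1r ca_mul1l addr0.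
by rewrite eq_sym (negbTE kl) scale0r ca_mul0l.
Qed.

End Resolution.

(** * Octonionic 3-vectors and the characteristic operator in coordinates *)

Local Notation i0 := (ord0 : 'I_3).
Local Notation i1 := (lift ord0 ord0 : 'I_3).
Local Notation i2 := (lift ord0 (lift ord0 ord0) : 'I_3).

Lemma ord3_ind (P : 'I_3 -> Prop) : P i0 -> P i1 -> P i2 -> forall i, P i.
Proof.
move=> h0 h1 h2 [[|[|[|//]]] hi].
- by rewrite (_ : Ordinal hi = i0) //; apply: val_inj.
- by rewrite (_ : Ordinal hi = i1) //; apply: val_inj.
- by rewrite (_ : Ordinal hi = i2) //; apply: val_inj.
Qed.

Lemma sum_ord2 (V : zmodType) (F : 'I_2 -> V) : \sum_(m < 2) F m = F 0 + F 1.
Proof.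
rewrite !big_ord_recl big_ord0 addr0; congr (F _ + F _); exact: val_inj.
Qed.

Section OctonionMatrices.
Context {R : realType}.
Local Notation O := (oct_comp_algebra R).
Implicit Types (x y v : 'cV[oct R]_3) (s : R).

Lemma omulmxE m n k (M : 'M[oct R]_(m, n)) (N : 'M[oct R]_(n, k)) i j :
  (M *om N) i j = \sum_l M i l *o N l j.
Proof. by rewrite mxE. Qed.

Lemma oscalemxE m n s (M : 'M[oct R]_(m, n)) i j : (s *v M) i j = s *: M i j.
Proof. by rewrite mxE. Qed.

Lemma outer_mulE v y i :
  ((v *om v^†) *om y) i 0 = \sum_k (v i 0 *o oconj (v k 0)) *o y k 0.
Proof. by rewrite omulmxE; apply: eq_bigr => k _; rewrite omulmxE big_ord1 !mxE. Qed.

Lemma lincomb4E (W Z Y X : 'cV[oct R]_3) s t u i :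
  (W - s *v Z + t *v Y - u *v X) i 0
  = W i 0 - s *: Z i 0 + t *: Y i 0 - u *: X i 0.
Proof. by rewrite !mxE. Qed.

Lemma orealE s : oreal s = s *: oreal 1.
Proof. oct_ring. Qed.

Lemma ore_dagger_mul v : ore ((v^† *om v) 0 0) = \sum_k onormsq (v k 0).
Proof.
have ore_sum (F : 'I_3 -> oct R) : ore (\sum_k F k) = \sum_k ore (F k).
  by apply: (big_morph (@ore R)).
rewrite omulmxE ore_sum; apply: eq_bigr => k _; rewrite !mxE onormsq_coord.
by case: (v k 0) => [[[? ?] [? ?]] [[? ?] [? ?]]]; rewrite /ore /=; ring.
Qed.

Section Herm.
Variables (d e f : R) (a b c : oct R).
Local Notation A := (herm d e f a b c).

Lemma herm_mul x :
  [/\ (A *om x) i0 0 = d *: x i0 0 + a *o x i1 0 + oconj b *o x i2 0,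
      (A *om x) i1 0 = oconj a *o x i0 0 + e *: x i1 0 + c *o x i2 0
    & (A *om x) i2 0 = b *o x i0 0 + oconj c *o x i1 0 + f *: x i2 0].
Proof.
by split; rewrite omulmxE !big_ord_recl big_ord0 addr0 addrA !oscaleE !mxE.
Qed.

Lemma herm_sigmaE : herm_sigma d e f a b c =
  d * e + d * f + e * f - (onormsq a + onormsq b + onormsq c).
Proof.
rewrite /herm_sigma tr_herm_sq [ore (oreal _)](erefl (d ^+ 2 + e ^+ 2 + f ^+ 2
  + 2 * (onormsq a + onormsq b + onormsq c))) /herm_tr.
by field.
Qed.

(** The left side is [cross_shift] less the triple term of the determinant, written over the
    concrete octonions so that it can be expanded in real coordinates. *)
Lemma Phi_expand :
  let im (p : oct R) := p - ore p *: oreal 1 in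
  let dot p q := ore (p *o oconj q) in
  2 * (ore a * ore b * ore c - ore a * dot (im b) (im c)
       - ore b * dot (im a) (im c) - ore c * dot (im a) (im b))
  - 2 * ore (b *o (a *o c)) = - (2 * Phi a b c).
Proof.
rewrite /Phi mulrA mulfV ?pnatr_eq0 // mul1r.
case: a => [[[? ?] [? ?]] [[? ?] [? ?]]].
case: b => [[[? ?] [? ?]] [[? ?] [? ?]]].
case: c => [[[? ?] [? ?]] [[? ?] [? ?]]].
by rewrite /ore /= ?scale_regularE; ring.
Qed.

Lemma cross_shift_Phi :
  @cross_shift R O a b c - 2 * ore (b *o (a *o c)) = - (2 * Phi a b c).
Proof. exact: Phi_expand. Qed.

Lemma charK_coord x i : charK d e f a b c x i 0
  = @cross R O a c b (x i 0) - (2 * Phi a b c) *: x i 0.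
Proof.
rewrite -scaleNr -cross_shift_Phi /charK herm_sigmaE /herm_tr /herm_det lincomb4E.
have [z0 z1 z2] := herm_mul (A *om (A *om x)); have [y0 y1 y2] := herm_mul (A *om x).
have [x0 x1 x2] := herm_mul x.
move: (A *om (A *om (A *om x))) z0 z1 z2 => W z0 z1 z2.
move: (A *om (A *om x)) y0 y1 y2 z0 z1 z2 => Z y0 y1 y2 z0 z1 z2.
move: (A *om x) x0 x1 x2 y0 y1 y2 z0 z1 z2 => Y x0 x1 x2 y0 y1 y2 z0 z1 z2.
have [r0 r1 r2] := @char_rows R O d e f (2 * ore (b *o (a *o c))) a b c
  (x i0 0) (x i1 0) (x i2 0).
move: i; apply: ord3_ind.
- by move: r0; rewrite z0 y0 y1 y2 x0 x1 x2.
- by move: r1; rewrite z1 y0 y1 y2 x0 x1 x2.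
- by move: r2; rewrite z2 y0 y1 y2 x0 x1 x2.
Qed.

(** By [charK_coord] the shift [r + 4 Phi] of K becomes [r + 2 Phi] for [cross], so this has the
    form treated in [cross_proj]. *)
Lemma projK_coord r x i : projK d e f a b c r x i 0 =
  (2 * (r + 2 * Phi a b c))^-1 *:
    (@cross R O a c b (x i 0) + (r + 2 * Phi a b c) *: x i 0).
Proof.
rewrite /projK oscalemxE; congr (_ *: _).
have := charK_coord x i; move: (charK _ _ _ _ _ _ x) => y; rewrite mxE oscalemxE => ->.
rewrite -addrA -scaleNr -scalerDl; congr (_ + _ *: _); ring.
Qed.

Lemma herm_frame_spanned i j : @frame_spanned R O a b c (A i j).
Proof.
move=> k1 k2 k3 ha hb hc; rewrite mxE.
have real (s : R) : @qspan R O k1 k2 k3 (oreal s).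
  by rewrite orealE; exact: qspan_real.
have ha' := qspan_conj _ _ _ _ ha; have hb' := qspan_conj _ _ _ _ hb.
have hc' := qspan_conj _ _ _ _ hc.
by move: i j; apply: ord3_ind; apply: ord3_ind => //=.
Qed.

End Herm.
End OctonionMatrices.

Theorem mainTheorem3 (R : realType) (d e f : R) (a b c : oct R)
    (halpha : alpha a b c <> 0)
    (r : 'I_2 -> R) (hr12 : r 0 <> r 1)
    (hr : forall m, r m ^+ 2 + 4 * Phi a b c * r m - onormsq (alpha a b c) = 0)
    (v : 'I_2 -> 'I_3 -> 'cV[oct R]_3) (lambda : 'I_2 -> 'I_3 -> R)
    (hortho : forall m, orthonormal_family (v m))
    (heig : forall m j, herm d e f a b c *om v m j = lambda m j *v v m j)
    (hK : forall m j, charK d e f a b c (v m j) = r m *v v m j) :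
  forall x : 'cV[oct R]_3,
    x = \sum_(m < 2) \sum_(j < 3)
          (v m j *om (v m j)^†) *om projK d e f a b c (r m) x
    /\ forall m j,
      herm d e f a b c
        *om ((v m j *om (v m j)^†) *om projK d e f a b c (r m) x)
      = lambda m j *v ((v m j *om (v m j)^†) *om projK d e f a b c (r m) x).
Proof.
(* [g m] is the eigenvalue of [cross] on the coordinates of [v m j], as K is [cross] minus
   [2 Phi]. *)
pose O := oct_comp_algebra R; pose g m := r m + 2 * Phi a b c.
(* The two roots sum to [- 4 Phi]. *)
have g01 : g 1 = - g 0.
  have r01 : r 0 - r 1 != 0 by apply/eqP => /subr0_eq.
  have : (r 0 - r 1) * (r 0 + r 1 + 4 * Phi a b c) = 0.
    by rewrite -[RHS](subrr 0) -{1}(hr 0) -(hr 1); ring.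
  move/eqP; rewrite mulf_eq0 (negbTE r01) /= => /eqP h.
  by apply/eqP; rewrite -addr_eq0 -h /g; apply/eqP; ring.
(* Opposite values that vanish would coincide, against the distinctness of the roots. *)
have g_neq0 m : g m != 0.
  have h0 : g 0 != 0.
    apply/eqP => g0; apply: hr12.
    have : g 0 = g 1 by rewrite g01 g0 oppr0.
    by move/addIr.
  have : m = 0 \/ m = 1 by case: m => [[|[|//]] hm]; [left|right]; apply: val_inj.
  by case=> ->; rewrite ?g01 ?oppr_eq0.
have cross_v m j l : @cross R O a c b (v m j l 0) = g m *: (v m j l 0 : O).
  have := congr1 (fun w : 'cV[oct R]_3 => w l 0) (hK m j).
  rewrite /= charK_coord oscalemxE => /(canRL (subrK _)) ->.
  by rewrite -scalerDl.
have norm_v m j : \sum_k ca_norm (v m j k 0 : O) = 1.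
  by have := ore_dagger_mul (v m j); case: (hortho m) => -> _ => <-.
have ortho_v m i j : i != j ->
    forall l, \sum_k ca_mul (ca_mul (v m i l 0 : O) (ca_conj (v m i k 0 : O))) (v m j k 0) = 0.
  case: (hortho m) => _ h /h [hij _] l.
  have := congr1 (fun w : 'cV[oct R]_3 => w l 0) hij.
  by rewrite /= outer_mulE mxE.
move=> x; split=> [|m j].
  apply/matrixP => l n; rewrite ord1 {n} summxE.
  (* For each [m] the sum over [j] collapses to K_m[x]; it remains to see that the two projections
     add up to [x]. *)
  transitivity (\sum_(m < 2) projK d e f a b c (r m) x l 0); last first.
    apply: eq_bigr => m _; rewrite summxE.
    under eq_bigr do rewrite outer_mulE.
    exact: esym (@orthonormal_resolution_mul R O 3 (fun j k => v m j k 0)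
      (fun k => projK d e f a b c (r m) x k 0) l (norm_v m) (ortho_v m)).
  have p0 : projK d e f a b c (r 0) x l 0 = (2 * g 0)^-1 *:
      (@cross R O a c b (x l 0) + g 0 *: (x l 0 : O)) by exact: projK_coord.
  have p1 : projK d e f a b c (r 1) x l 0 = (2 * - g 0)^-1 *:
      (@cross R O a c b (x l 0) + - g 0 *: (x l 0 : O)).
    by rewrite -g01; exact: projK_coord.
  refine (etrans _ (esym (sum_ord2 _ (fun m => projK d e f a b c (r m) x l 0)))).
  refine (etrans (@proj_sum R O (g 0) _ (@cross R O a c b (x l 0)) (g_neq0 0)) _).
  exact (esym (f_equal2 +%R p0 p1)).
apply/matrixP => l n; rewrite ord1 {n} oscalemxE omulmxE.
under eq_bigr do rewrite outer_mulE.
rewrite outer_mulE.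
refine (@cross_outer_eigen R O a b c (g m) 3 (herm d e f a b c l)
  (fun k => v m j k 0) (fun k => projK d e f a b c (r m) x k 0) (lambda m j) l
  (g_neq0 m) (herm_frame_spanned d e f a b c l) (cross_v m j) _ _) => [k|].
  (* The unit vector [v m j] fixes the square of [cross], which puts the coordinates of K_m[x] in
     the eigenspace of [g m]. *)
  have sq := @cross_sq_unit R O _ _ _ _ _ _ (norm_v m j) (cross_v m j).
  by rewrite projK_coord; exact: (@cross_proj R O _ _ _ _ (x k 0) sq).
have := congr1 (fun w : 'cV[oct R]_3 => w l 0) (heig m j).
by rewrite /= omulmxE oscalemxE.
Qed.
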